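(* Let $n$ be odd, and let $r,s>0$ be integers such that $r+s=n$ and $\gcd(r,s)=1$. Then: (i) if every prime $p$ dividing $n$ satisfies $p\equiv 3\pmod 8$ then $(r,s)$ flips; (ii) if every prime $p$ dividing $n$ satisfies $p\equiv 5\pmod 8$ then $(r,s)$ flips; (iii) if $n$ is divisible by primes $p,q$ with $p\equiv 3\pmod 8$ and $q\equiv 5\pmod 8$ then $(r,s)$ does not flip; (iv) if $n$ is divisible by a prime $p$ with $p\equiv 7\pmod 8$ then $(r,s)$ does not flip.
   Context: $\mathbb{N}^+$ is the set of positive integers. Consider the partial maps on $\mathbb{N}^+\times\mathbb{N}^+$: $\alpha(r,s)=(2r,s-r)$, defined iff $s>r$; $\beta(r,s)=(r-s,2s)$, defined iff $r>s$; $\gamma(r,s)=(r/2,s+r/2)$, defined iff $r$ is even; $\delta(r,s)=(r+s/2,s/2)$, defined iff $s$ is even. The orbit $O(r,s)$ is the set of all points $\varphi_k\cdots\varphi_1(r,s)$ with $k\ge 0$ and $\varphi_i\in\{\alpha,\beta,\gamma,\delta\}$ (whenever the composition is defined). We say that $(r,s)$ flips if $(s,r)\in O(r,s)$. *)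

(* Defs.v *)
From mathcomp Require Import all_boot.

Set Implicit Arguments.
Unset Strict Implicit.
Unset Printing Implicit Defensive.

(* Points of N+ x N+ are pairs of naturals; a partial map is option-valued and
   the positivity of the arguments is part of its domain. *)
Definition point : Type := (nat * nat)%type.

Definition alpha (x : point) : option point :=
  let: (r, s) := x in
  if [&& 0 < r, 0 < s & r < s] then Some (2 * r, s - r) else None.

Definition beta (x : point) : option point :=
  let: (r, s) := x in
  if [&& 0 < r, 0 < s & s < r] then Some (r - s, 2 * s) else None.

Definition gamma (x : point) : option point :=
  let: (r, s) := x in
  if [&& 0 < r, 0 < s & 2 %| r] then Some (r %/ 2, s + r %/ 2) else None.

Definition delta (x : point) : option point :=
  let: (r, s) := x in
  if [&& 0 < r, 0 < s & 2 %| s] then Some (r + s %/ 2, s %/ 2) else None.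

Inductive letter := Alpha | Beta | Gamma | Delta.

Definition act (a : letter) : point -> option point :=
  match a with
  | Alpha => alpha
  | Beta => beta
  | Gamma => gamma
  | Delta => delta
  end.

(* [:: phi_1; ...; phi_k] acts as the composite phi_k ... phi_1. *)
Definition act_word (w : seq letter) (x : point) : option point :=
  foldl (fun o a => obind (act a) o) (Some x) w.

Definition in_orbit (x y : point) : Prop :=
  exists w : seq letter, act_word w x = Some y.

Definition flips (r s : nat) : Prop := in_orbit (r, s) (s, r).

(* Main.v *)
Require Import Defs.
From mathcomp Require Import all_boot.
From mathcomp Require Import all_algebra cyclic.
From mathcomp Require Import zify ring.

(** Fix an odd [n = r + s].  A point of the orbit is determined by its first
    coordinate, an element of Z/n: there [alpha] and [beta] are the two cases
    (without and with wrap-around) of doubling modulo [n], while [gamma] and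
    [delta] are the two cases of halving.  Since 2 has finite order modulo [n],
    halving is a power of doubling, so the orbit consists of the points whose
    first coordinate is [2 ^ k * r] for some [k] ([orbitP]).  As
    [s = - r] modulo [n] and [r] is invertible, [(r, s)] flips if and only if
    -1 is a power of 2 modulo [n] ([flipsP]).

    What remains is the parity of the exponents.  Gauss's computation of
    [2 ^ ((p - 1) / 2)] modulo a prime [p] ([exp2_half_Fp]) yields an odd [b]
    with [2 ^ b = -1] if [p = 3], with [4 ^ b = -1] if [p = 5], and with
    [2 ^ b = 1] if [p = 7] modulo 8.

    For the positive parts, the base being 2 or 4, having -1 as an odd power is
    a property that passes from the primes dividing [n] to [n] itself
    ([odd_power_opp1]), because [y = -1] modulo [m] and modulo [p] implies
    [y ^ p = -1] modulo [m * p].  For the negative parts, suppose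
    [2 ^ m = -1] modulo [n].  A prime divisor [p = 7] gives
    [1 = 2 ^ (m * b) = (-1) ^ b = -1] modulo [p]; a prime divisor [p = 3]
    forces [m] to be odd, whereas [p = 5] forces it to be even. *)

Set Implicit Arguments.
Unset Strict Implicit.
Unset Printing Implicit Defensive.

Import GRing.Theory.

(** * The orbit is the set of multiples by powers of two *)

Lemma act_double_or_halve a x y x' y' :
  act a (x, y) = Some (x', y') ->
  [/\ 0 < x', 0 < y', x' + y' = x + y &
      (x' = 2 * x %[mod x + y]) \/ (2 * x' = x %[mod x + y])].
Proof.
case: a => /=; case: ifP => // /and3P[x_gt0 y_gt0 xyP] [<- <-].
- by split; [lia | lia | lia | left].
- split; [lia | lia | lia | left].
  by rewrite -(modnDr (x - y)); congr (_ %% _); lia.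
- by split; [lia | lia | lia | right; congr (_ %% _); lia].
- split; [lia | lia | lia | right].
  by rewrite -(modnDr x); congr (_ %% _); lia.
Qed.

Lemma double_step x y :
  0 < x -> 0 < y -> odd (x + y) ->
  exists a x' y', act a (x, y) = Some (x', y') /\ x' = 2 * x %[mod x + y].
Proof.
move=> x_gt0 y_gt0 xy_odd; have [ltxy|ltyx|eqxy] := ltngtP x y.
- by exists Alpha, (2 * x), (y - x); rewrite /= x_gt0 y_gt0 ltxy.
- exists Beta, (x - y), (2 * y); rewrite /= x_gt0 y_gt0 ltyx; split=> //.
  by rewrite -(modnDr (x - y)); congr (_ %% _); lia.
- by move: xy_odd; rewrite eqxy addnn odd_double.
Qed.

(** Halving stays among the multiples [2 ^ k * r] because modulo an odd number
    it is the [(totient n - 1)]-fold doubling. *)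
Lemma halve_as_power n r x z k :
  odd n -> z = 2 ^ k * r %[mod n] -> 2 * x = z %[mod n] ->
  exists l, x = 2 ^ l * r %[mod n].
Proof.
move=> n_odd zE xE; have n_gt0 : 0 < n by case: n n_odd {zE xE}.
have co2n : coprime 2 n by rewrite coprime2n.
have tn_gt0 : 0 < totient n by rewrite totient_gt0.
exists (k + (totient n).-1).
have halfE u v : (2 * u == 2 * v %[mod n]) = (u == v %[mod n]).
  wlog le_vu : u v / v <= u.
    by move=> W; case/orP: (leq_total u v) => /W // E; rewrite eq_sym E eq_sym.
  rewrite !eqn_mod_dvd ?leq_mul2l // -mulnBr Gauss_dvdr //.
  by rewrite coprime_sym.
apply/eqP; rewrite -halfE xE zE mulnA -expnS -addnS prednK // expnD.
rewrite -mulnA mulnCA -(modnMml (2 ^ totient n)).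
by rewrite Euler_exp_totient // modnMml mul1n.
Qed.

Lemma orbitP r s x y :
  0 < r -> 0 < s -> odd (r + s) ->
  Defs.in_orbit (r, s) (x, y) <->
    [/\ 0 < x, 0 < y, x + y = r + s & exists k, x = 2 ^ k * r %[mod r + s]].
Proof.
move=> r_gt0 s_gt0 n_odd; split.
  case=> w; elim/last_ind: w x y => [|w a IHw] x y.
    by case=> <- <-; split=> //; exists 0; rewrite mul1n.
  rewrite /act_word foldl_rcons -/(act_word w (r, s)).
  case Ew: (act_word w (r, s)) => [[u v]|] //= act_a.
  have [u_gt0 v_gt0 uvE [k uE]] := IHw _ _ Ew.
  have [x_gt0 y_gt0 xyE xP] := act_double_or_halve act_a.
  split; rewrite ?xyE //; rewrite uvE in xP.
  case: xP => xP; last exact: halve_as_power n_odd uE xP.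
  by exists k.+1; rewrite xP expnS -mulnA -modnMmr uE modnMmr.
case=> x_gt0 y_gt0 xyE [k xE].
have [u [v [[w Ew] u_gt0 v_gt0 uvE uE]]] : exists u v,
    [/\ Defs.in_orbit (r, s) (u, v), 0 < u, 0 < v, u + v = r + s
      & u = 2 ^ k * r %[mod r + s]].
  elim: k {xE} => [|k [u [v [[w Ew] u_gt0 v_gt0 uvE uE]]]].
    by exists r, s; split; rewrite ?mul1n //; exists [::].
  have uv_odd : odd (u + v) by rewrite uvE.
  have [a [u' [v' [act_a u'E]]]] := double_step u_gt0 v_gt0 uv_odd.
  have [u'_gt0 v'_gt0 uv'E _] := act_double_or_halve act_a.
  exists u', v'; split; rewrite ?uv'E //.
    by exists (rcons w a); rewrite /act_word foldl_rcons -/(act_word _ _) Ew.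
  by move: u'E; rewrite uvE => ->; rewrite expnS -mulnA -modnMmr uE modnMmr.
have eq_ux : u = x by move: uE; rewrite -xE !modn_small //; lia.
by exists w; rewrite Ew; congr (Some (_, _)); lia.
Qed.

Lemma flipsP r s :
  0 < r -> 0 < s -> odd (r + s) -> coprime r s ->
  flips r s <-> exists m, r + s %| 2 ^ m + 1.
Proof.
move=> r_gt0 s_gt0 n_odd co_rs.
have congrE m : (s == 2 ^ m * r %[mod r + s]) = (r + s %| 2 ^ m + 1).
  have co_nr : coprime (r + s) r by rewrite /coprime gcdnC gcdnDl.
  rewrite -(Gauss_dvdl (2 ^ m + 1) co_nr) mulnDl mul1n /dvdn.
  rewrite -(eqn_modDr r) [s + r]addnC modnn eq_sym.
  by [].
rewrite /flips orbitP //; split=> [[_ _ _ [m /eqP]]|[m]].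
  by rewrite congrE; exists m.
by rewrite -congrE => /eqP mE; split=> //; [exact: addnC | exists m].
Qed.

(** * Odd powers equal to -1 *)

Open Scope ring_scope.

(** The cofactor of [y + 1] in [y ^ e + 1], for [e] odd, is [e] modulo
    [y + 1]: it is the sum of the [(- y) ^ i] for [i < e], and [- y = 1]. *)
Lemma odd_expD1_factor (R : comNzRingType) (y : R) j :
  exists u, y ^+ j.*2.+1 + 1 = (y + 1) * (j.*2.+1%:R + (y + 1) * u).
Proof.
elim: j => [|j [u IHj]]; first by exists 0; rewrite mulr0 addr0 mulr1.
exists (j.*2.+1%:R * (y - 1) + y ^+ 2 * u - 1).
have -> : y ^+ (j.+1).*2.+1 = y ^+ 2 * (y ^+ j.*2.+1 + 1 - 1).
  by rewrite addrK -exprD doubleS.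
rewrite IHj doubleS -[j.*2.+3%N]addn2 natrD; move: (j.*2.+1%:R) => e; ring.
Qed.

Close Scope ring_scope.

Lemma dvdn_odd_expD1 e y : odd e -> y + 1 %| y ^ e + 1.
Proof.
move=> e_odd; have [u] := odd_expD1_factor (Posz y) e./2.
have -> : e./2.*2.+1 = e by rewrite -[RHS]odd_double_half e_odd.
move=> E; have -> : y + 1 %| y ^ e + 1 = ((Posz y + 1)%R %| (Posz y ^+ e + 1)%R)%Z.
  by rewrite -rmorphXn.
by rewrite E dvdz_mulr.
Qed.

(** As [e] divides [y + 1], it also divides the cofactor, which is [e] modulo
    [y + 1]: this is where the second factor of [d * e] comes from. *)
Lemma dvdn_mul_odd_expD1 d e y :
  odd e -> d %| y + 1 -> e %| y + 1 -> d * e %| y ^ e + 1.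
Proof.
move=> e_odd d_y e_y; have [u] := odd_expD1_factor (Posz y) e./2.
have -> : e./2.*2.+1 = e by rewrite -[RHS]odd_double_half e_odd.
move=> E; have -> : d * e %| y ^ e + 1 = (Posz (d * e) %| (Posz y ^+ e + 1)%R)%Z.
  by rewrite -rmorphXn.
rewrite E PoszM dvdz_mul //.
by rewrite rpredD // ?natz ?dvdzz // dvdz_mulr.
Qed.

(** Let [p] be a prime dividing [n = n' * p].  If [c ^ a = -1] modulo [n'] and
    [c ^ b = -1] modulo [p] with [a] and [b] odd, then [y = c ^ (a * b)] is -1
    modulo both, hence [y ^ p = -1] modulo [n' * p], even when [p] divides
    [n']. *)
Lemma odd_power_opp1 c n :
  odd n ->
  (forall p, prime p -> p %| n -> exists2 b, odd b & p %| c ^ b + 1) ->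
  exists2 m, odd m & n %| c ^ m + 1.
Proof.
have [k] := ubnP n; elim: k n => // k IHk n lt_nk n_odd hyp.
have [n_le1|n_gt1] := leqP n 1.
  by exists 1 => //; have -> : n = 1 by [case: n n_odd n_le1 {lt_nk hyp} => [|[]]];
    rewrite dvd1n.
have p_pr := pdiv_prime n_gt1; have p_n := pdiv_dvd n.
have [b b_odd p_cb] := hyp _ p_pr p_n.
move: p_n p_pr p_cb; set p := pdiv n => /dvdnP[n' nE] p_pr p_cb.
have [n'_odd p_odd] : odd n' /\ odd p by apply/andP; rewrite -oddM -nE.
have n'_gt0 : 0 < n' by case: (n') n'_odd.
have [|//|q q_pr q_n'|a a_odd n'_ca] := IHk n'.
- by rewrite ltnS in lt_nk; apply: leq_trans lt_nk; rewrite nE ltn_Pmulr ?prime_gt1.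
- by apply: hyp; rewrite // nE dvdn_mulr.
exists (a * b * p); first by rewrite !oddM a_odd b_odd.
rewrite nE expnM dvdn_mul_odd_expD1 //.
  by rewrite expnM (dvdn_trans n'_ca) ?dvdn_odd_expD1.
by rewrite mulnC expnM (dvdn_trans p_cb) ?dvdn_odd_expD1.
Qed.

(** * The quadratic character of two and the parity of exponents *)

Open Scope ring_scope.

Lemma odd_bin2 k : odd 'C(k.+1, 2) = odd (uphalf k).
Proof.
have [m] := ubnP k; elim: m k => // m IHm [|[|k]] // lt_km.
rewrite (binS k.+2) (binS k.+1) !bin1 oddD oddD IHm; last by lia.
by rewrite -[uphalf k.+2]/(uphalf k).+1 !oddS; do 2 case: odd.
Qed.

(** Modulo [p = 2 * k + 1], the numbers [(-1) ^ j * j] with [1 <= j <= k] are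
    the even numbers [2, 4, .., 2 * k] in another order: an even [j] stands for
    itself, an odd [j] for [- j = p - j].  Multiplying them all and cancelling
    [k!] gives [2 ^ k] as the sign [(-1) ^ (1 + 2 + .. + k)]. *)
Lemma exp2_half_Fp p :
  prime p -> odd p -> 2%:R ^+ p./2 = (-1) ^+ uphalf p./2 :> 'F_p.
Proof.
move=> p_pr p_odd; set k := p./2.
have pE : p = k.*2.+1 by rewrite -[LHS]odd_double_half p_odd.
(* For [j = i + 1], the even number matched with [j] is [2 * (h i + 1)]. *)
pose h i := (if odd i then i./2 else k - i./2.+1)%N.
have h_lt (i : 'I_k) : (h i < k)%N by rewrite /h; have := ltn_ord i; case: ifP; lia.
pose h_ord i := Ordinal (h_lt i).
have h_inj : injective h_ord.
  move=> i j /(congr1 val) /=; rewrite /h => hE; apply: val_inj => /=.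
  by have := ltn_ord i; have := ltn_ord j; move: hE; do 2 case: ifP; lia.
have hE (i : 'I_k) : (2 * (h i).+1)%:R = (-1) ^+ i.+1 * i.+1%:R :> 'F_p.
  rewrite -signr_odd /= /h; case: ifP => i_odd.
    by rewrite mul1r; congr _%:R; lia.
  rewrite expr1 mulN1r; apply/eqP; rewrite -subr_eq0 opprK -natrD.
  have -> : (2 * (k - i./2.+1).+1 + i.+1 = p)%N.
    by have := ltn_ord i; rewrite pE; lia.
  by rewrite pchar_Fp_0.
have fact_neq0 : \prod_(i < k) i.+1%:R != 0 :> 'F_p.
  apply/prodf_neq0 => i _; rewrite -(dvdn_pcharf (pchar_Fp p_pr)) gtnNdvd //.
  by have := ltn_ord i; rewrite pE; lia.
have signE : \prod_(i < k) (-1) ^+ i.+1 = (-1) ^+ uphalf k :> 'F_p.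
  rewrite -[RHS]signr_odd -odd_bin2 signr_odd -bin2_sum big_mkord.
  by rewrite big_ord_recl add0n expr_sum.
apply: (mulIf fact_neq0); rewrite -signE -big_split /=.
have -> : 2%:R ^+ k = \prod_(i < k) 2%:R :> 'F_p by rewrite prodr_const card_ord.
rewrite -big_split /=.
rewrite (reindex_inj h_inj) /=; apply: eq_bigr => i _.
by rewrite -hE natrM.
Qed.

Lemma dvdn_expD1_Fp p c m :
  prime p -> (p %| c ^ m + 1)%N = (c%:R ^+ m == -1 :> 'F_p).
Proof.
by move=> p_pr; rewrite (dvdn_pcharf (pchar_Fp p_pr)) natrD natrX addr_eq0.
Qed.

Lemma Fp_opp1_neq1 p : prime p -> odd p -> (-1 : 'F_p) != 1.
Proof.
move=> p_pr p_odd; rewrite eq_sym -addr_eq0 -[1 + 1]/(2%:R).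
rewrite -(dvdn_pcharf (pchar_Fp p_pr)) dvdn_prime2 //.
by apply: contraTneq p_odd => ->.
Qed.

Lemma exp2_mod8_3 p :
  prime p -> p = 3 %[mod 8] -> exists2 b, odd b & 2%:R ^+ b = -1 :> 'F_p.
Proof.
move=> p_pr p3; have p_odd : odd p by lia.
exists p./2; first by lia.
by rewrite exp2_half_Fp // -signr_odd; have -> : odd (uphalf p./2) by lia.
Qed.

Lemma exp2_mod8_5 p :
  prime p -> p = 5 %[mod 8] -> exists2 b, odd b & 4%:R ^+ b = -1 :> 'F_p.
Proof.
move=> p_pr p5; have p_odd : odd p by lia.
exists (p./2)./2; first by lia.
rewrite (natrM _ 2 2) -expr2 -exprM; have -> : (2 * (p./2)./2 = p./2)%N by lia.
by rewrite exp2_half_Fp // -signr_odd; have -> : odd (uphalf p./2) by lia.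
Qed.

Lemma exp2_mod8_7 p :
  prime p -> p = 7 %[mod 8] -> exists2 b, odd b & 2%:R ^+ b = 1 :> 'F_p.
Proof.
move=> p_pr p7; have p_odd : odd p by lia.
exists p./2; first by lia.
rewrite exp2_half_Fp // -signr_odd.
by have -> : odd (uphalf p./2) = false by lia.
Qed.

(** With [2 ^ b = -1] and [b] odd, [(-1) ^ m = 2 ^ (b * m) = (-1) ^ b = -1]. *)
Lemma opp1_power2_odd p m :
  prime p -> p = 3 %[mod 8] -> 2%:R ^+ m = -1 :> 'F_p -> odd m.
Proof.
move=> p_pr p3 mE; have p_odd : odd p by lia.
have [b b_odd bE] := exp2_mod8_3 p_pr p3.
have: (2%:R ^+ b) ^+ m = (2%:R ^+ m) ^+ b :> 'F_p by rewrite -!exprM mulnC.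
rewrite bE mE -signr_odd -[RHS]signr_odd b_odd; case: (odd m) => //= /eqP.
by rewrite eq_sym expr1 (negPf (Fp_opp1_neq1 p_pr p_odd)).
Qed.

(** With [4 ^ b = -1], [(-1) ^ m = 2 ^ (2 * b * m) = (-1) ^ (2 * b) = 1]. *)
Lemma opp1_power2_even p m :
  prime p -> p = 5 %[mod 8] -> 2%:R ^+ m = -1 :> 'F_p -> ~~ odd m.
Proof.
move=> p_pr p5 mE; have p_odd : odd p by lia.
have [b _ bE] := exp2_mod8_5 p_pr p5.
have: (4%:R ^+ b) ^+ m = (2%:R ^+ m) ^+ (2 * b) :> 'F_p.
  by rewrite (natrM _ 2 2) -expr2 -!exprM; congr (_ ^+ _); lia.
rewrite bE mE -signr_odd exprM sqrrN expr1n expr1n; case: (odd m) => //= /eqP.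
by rewrite expr1 (negPf (Fp_opp1_neq1 p_pr p_odd)).
Qed.

Lemma power2_neq_opp1 p m :
  prime p -> p = 7 %[mod 8] -> 2%:R ^+ m != -1 :> 'F_p.
Proof.
move=> p_pr p7; have p_odd : odd p by lia.
have [b b_odd bE] := exp2_mod8_7 p_pr p7; apply/eqP => mE.
have /eqP : (2%:R ^+ m) ^+ b = (2%:R ^+ b) ^+ m :> 'F_p.
  by rewrite -!exprM mulnC.
rewrite bE mE expr1n -signr_odd b_odd expr1.
by rewrite (negPf (Fp_opp1_neq1 p_pr p_odd)).
Qed.

Close Scope ring_scope.

(** * Flipping according to the prime divisors modulo 8 *)

Theorem theorem4p8 (n r s : nat) (hn : odd n) (hr : 0 < r) (hs : 0 < s)
    (hrs : r + s = n) (hgcd : gcdn r s = 1) :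
  [/\ (forall p : nat, prime p -> p %| n -> p = 3 %[mod 8]) -> flips r s,
      (forall p : nat, prime p -> p %| n -> p = 5 %[mod 8]) -> flips r s,
      (exists p q : nat,
         [/\ prime p, prime q, p %| n & q %| n] /\
         (p = 3 %[mod 8] /\ q = 5 %[mod 8])) -> ~ flips r s
    & (exists p : nat, [/\ prime p, p %| n & p = 7 %[mod 8]]) -> ~ flips r s].
Proof.
have flipE : flips r s <-> exists m, n %| 2 ^ m + 1.
  by rewrite -hrs; apply: flipsP; rewrite ?hrs // /coprime hgcd.
have FpE p m : prime p -> p %| n -> n %| 2 ^ m + 1 -> (2%:R ^+ m = -1 :> 'F_p)%R.
  move=> p_pr p_n n_m; apply/eqP; rewrite -dvdn_expD1_Fp //.
  exact: dvdn_trans p_n n_m.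
split=> [n3|n5|[p [q [[p_pr q_pr p_n q_n] [p3 q5]]]]|[p [p_pr p_n p7]]].
- apply/flipE; have [p p_pr p_n|m _ n_m] := @odd_power_opp1 2 n hn.
    have [b b_odd /eqP] := exp2_mod8_3 p_pr (n3 p p_pr p_n).
    by rewrite -dvdn_expD1_Fp //; exists b.
  by exists m.
- apply/flipE; have [p p_pr p_n|m _ n_m] := @odd_power_opp1 4 n hn.
    have [b b_odd /eqP] := exp2_mod8_5 p_pr (n5 p p_pr p_n).
    by rewrite -dvdn_expD1_Fp //; exists b.
  by exists (2 * m); rewrite expnM.
- move/flipE => [m n_m].
  have := opp1_power2_even q_pr q5 (FpE q m q_pr q_n n_m).
  by rewrite (opp1_power2_odd p_pr p3 (FpE p m p_pr p_n n_m)).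
- move/flipE => [m n_m]; move: (power2_neq_opp1 m p_pr p7).
  by rewrite (FpE p m p_pr p_n n_m) eqxx.
Qed.
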